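(* A composition of Turchin's relation $\preceq$ and an arbitrary well binary relation $R$ (well binary with respect to arbitrary sequences) is a well binary relation with respect to the set of the traces generated by the multi-layer prefix grammars. Here the composition holds between two elements of a trace when they form a Turchin pair and are related by $R$; so the statement says that every trace $\{\Xi_k\}$ generated by a multi-layer prefix grammar in which there are no $i<j$ with both $\Xi_i\preceq\Xi_j$ and $(\Xi_i,\Xi_j)\in R$ is finite.
   Context: **Well binary relation.** Given a set $T$ of terms and a set $S$ of sequences of terms from $T$, a relation $R\subset T\times T$ is well binary with respect to $S$ if every sequence $\{\Phi_n\}\in S$ such that $(\Phi_i,\Phi_j)\notin R$ for all $i<j$ is finite. **Labels and layered words.** $\Upsilon$ is a finite alphabet, $\mathbf{S}$ a label set with a strict partial order $\triangleleft$. For $\mathbf{S}'\subseteq\mathbf{S}$, $s_1$ is a child of $s_0$ w.r.t. $\mathbf{S}'$ if $s_0,s_1\in\mathbf{S}'$, $s_0\triangleleft s_1$, and there is no $s_2\in\mathbf{S}'$ with $s_0\triangleleft s_2\triangleleft s_1$. When $\mathbf{S}'$ is the set of all previously used labels, one writes $s_1=\mathrm{child}(s_0)$. Descendants of $s$ are the $t$ with $s\triangleleft t$, ancestors the $t$ with $t\triangleleft s$. A label $t\in\mathbf{S}\setminus\mathbf{S}'$ is fresh w.r.t. $\mathbf{S}'$ if $\mathbf{S}'$ contains neither descendants nor ancestors of $t$. A layered word is a finite sequence of pairs $\langle a,s\rangle$, $a\in\Upsilon$, $s\in\mathbf{S}$; $\Lambda$ is the empty word; $|\Phi|$ is the number of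 pairs in $\Phi$. The plain word of $\langle a_1,s_1\rangle\dots\langle a_n,s_n\rangle$ is $a_1\dots a_n$. $\Phi\langle s\rangle$ is the maximal subsequence of $\Phi$ containing only pairs labelled $s$; $\mathbf{S}_\Phi$ is the set of labels in $\Phi$. For $\Psi\in\Upsilon^*$, $\Psi\langle s\rangle$ is $\Psi$ with all letters labelled $s$. **Layer functions.** For a label $s_i$ and natural numbers $K_1,K_2$, $\mathfrak{F}^{s_i}_{K_1,K_2}$ is the minimal set of functions from layered words to layered words containing all compositions of $K_1$ elementary functions. In the following list, $s_i$ is counted among the labels of $\Phi$ when children of $s_i$ are considered. The elementary functions are: (1) Append $\mathrm{App}^{s_j}[\Psi]$ ($\Psi\in\Upsilon^*$): maps $\Phi$ to $\Phi\,\Psi\langle s_j\rangle$, where $s_j$ is a child of $s_i$ w.r.t. $\mathbf{S}_\Phi\cup\{s_j\}$, $s_j$ is fresh w.r.t. $\mathbf{S}_\Phi\setminus\{s_i\}$ (though $s_j$ itself may already occur in $\Phi$; e.g. for $s_0\triangleleft s_1$ and $\mathrm{App}^{s_1}[g]\in\mathfrak{F}^{s_0}_{1,1}$, $\mathrm{App}^{s_1}[g](\langle f,s_0\rangle\langle g,s_1\rangle)=\langle f,s_0\rangle\langle g,s_1\rangle\langle g,s_1\rangle$), and $|\Psi|\le K_2$. (2) Insert $\mathrm{Ins}^{s_j}[\Psi\langle s_k\rangle]$ ($\Psi\in\Upsilon^*$): for $\Phi$ with non-empty $\Phi\langle s_j\rangle$, $s_j$ a child of $s_i$ w.r.t. $\mathbf{S}_\Phi$,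 returns $\Phi\,\Psi\langle s_k\rangle$, where $|\Psi|\le K_2$, $s_k$ is a child of $s_i$ w.r.t. $\mathbf{S}_\Phi\cup\{s_k\}$, $s_j$ is a child of $s_k$ w.r.t. $\mathbf{S}_\Phi\cup\{s_k\}$, and $s_k$ is fresh w.r.t. $\mathbf{S}_\Phi\setminus\{s_i\}$ (apart from $s_j$ and the descendants of $s_j$). (3) Delete $\mathrm{Del}^{s_j}$: for $\Phi$ with non-empty $\Phi\langle s_j\rangle$, $s_j$ a child of $s_i$ w.r.t. $\mathbf{S}_\Phi$, erases $\Phi\langle s_j\rangle$ and all $\Phi\langle t\rangle$ with $s_j\triangleleft t$. (4) Copy $\mathrm{Copy}^{s_j}$: for $\Phi$ with non-empty $\Phi\langle s_j\rangle$, $s_j$ a child of $s_i$ w.r.t. $\mathbf{S}_\Phi$, appends to $\Phi$ a copy of $\Phi\langle s_j\rangle$ labelled by $s_k$, where $s_k$ is a child of $s_i$ w.r.t. $\mathbf{S}_\Phi\cup\{s_k\}$ and is fresh w.r.t. $\mathbf{S}_\Phi\setminus\{s_i\}$; then it appends copies of all subsequences labelled by the children of $s_j$, labelled by fresh children of $s_k$, and so on, until every $\Phi\langle t\rangle$ with $s_j\triangleleft t$ is copied exactly once (i.e. it creates a copy of the subtree rooted at $s_j$ as a new subtree below $s_i$). **Multi-layer prefix grammar.** A tuple $\mathbf{G}=\langle \Upsilon,\mathbf{S},\mathbf{R},\mathfrak{F}^{v}_{K_1,K_2},\Gamma_0\$\Delta_0\rangle$, where $\$\notin\Upsilon$ is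 a special symbol; $\Gamma_0,\Delta_0$ are layered words such that if the pair $\langle a_i,s_i\rangle$ precedes $\langle a_j,s_j\rangle$ in $\Gamma_0$ then $s_j\triangleleft s_i$ or $s_j=s_i$; $\mathfrak{F}^{v}_{K_1,K_2}$ is a finite set of layer function forms, $v$ running over $\mathbf{S}$; and all rewriting rules in $\mathbf{R}$ have one of the forms - simple rule: $\Xi\langle a,s_i\rangle\Theta\$\Psi\to\Phi\Theta\$F^{s_i}(\Psi)$; - pop rule: $\Xi\langle a,s_i\rangle\Theta\$\Psi\to\Psi\langle s_j\rangle\Phi\Theta\$F^{s_i}(\Psi)$, where $\Psi\langle s_j\rangle$ is the maximal subsequence of $\Psi$ marked by some $s_j=\mathrm{child}(s_i)$ (a pop rule may specify $s_j$, but cannot specify $\Psi\langle s_j\rangle$). In both, all letters of $\Phi$ are labelled by $s_i$ or by fresh descendants of $s_i$, and $F^{s_i}\in\mathfrak{F}^{s_i}_{K_1,K_2}$. In a $\mathbf{G}$-word $\Gamma\$\Delta$, the layered words $\Gamma$ and $\Delta$ are the visible and the invisible layer. A trace of $\mathbf{G}$ is a sequence of $\mathbf{G}$-words starting at $\Gamma_0\$\Delta_0$ that are transformed by the rules from $\mathbf{R}$. **Permanently stable suffix.** Let $N$ be the maximal number of letters of the visible layer rewritten by a rule of $\mathbf{R}$ (so every rule rewrites at most $N$ letters of the visible layer). Given a trace $\{\Gamma_k\$\Delta_k\}$ and its segment $[i,j]$, a suffix $\Theta$ of $\Gamma_i$ is permanently stable w.r.t. $[i,j]$ if all the words $\Gamma_k\$\Delta_k$,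 $i\le k<j$, are of the form $\Phi_k\Theta\$\Delta_k$ with $|\Phi_k|\ge N$, and $\Gamma_j=\Phi_j\Theta$, where $\Phi_j$ may be $\Lambda$. **Turchin pair (Turchin's relation).** Two words $\Xi_i=\Gamma_i\$\Delta_i$, $\Xi_j=\Gamma_j\$\Delta_j$ ($i<j$) of a trace form a Turchin pair, written $\Xi_i\preceq\Xi_j$, if $\Gamma_i=\Phi\Theta_0$, $\Gamma_j=\Phi'\Psi\Theta_0$, $\Phi$ equals $\Phi'$ as a plain word (up to the layer labels), and the suffix $\Theta_0$ is permanently stable w.r.t. $[i,j]$.
   Formalization: Permanent stability asks |Φ_k| ≥ min(N, |Γ_k|) instead of |Φ_k| ≥ N, so the empty suffix counts as stable when the visible layer has fewer than N letters; literally the claim fails (rules a→a, bb→b, trace a, a, a, …, R total). *)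

(* Defs.v *)
From HB Require Import structures.
From mathcomp Require Import all_boot all_order.

Set Implicit Arguments.
Unset Strict Implicit.
Unset Printing Implicit Defensive.

Import Order.TTheory.

Inductive sequence (T : Type) : Type :=
| Fin of seq T
| Inf of (nat -> T).

Definition entry T (u : sequence T) (k : nat) : option T :=
  match u with Fin s => onth s k | Inf f => Some (f k) end.

Definition is_finite T (u : sequence T) : Prop := exists s, u = Fin s.

Definition well_binary T (R : T -> T -> Prop) (A : sequence T -> Prop) : Prop :=
  forall u, A u ->
    (forall i j x y, i < j -> entry u i = Some x -> entry u j = Some y ->
       ~ R x y) ->
    is_finite u.

Section LayeredWords.

Context {d : Order.disp_t} {U : finType} {S : porderType d}.

Definition lword : Type := seq (U * S).

Implicit Types (L : seq S) (P : lword) (s t : S).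

Definition labels P : seq S := [seq p.2 | p <- P].
Definition plain P : seq U := [seq p.1 | p <- P].
Definition proj P s : lword := [seq p <- P | p.2 == s].
Definition mark (w : seq U) s : lword := [seq (a, s) | a <- w].

(* Finite label sets are represented by lists, read up to membership. *)
Definition child L s0 s1 : bool :=
  [&& s0 \in L, s1 \in L, (s0 < s1)%O & ~~ has (fun s => s0 < s < s1)%O L].

Definition fresh L t : bool :=
  (t \notin L) && ~~ has (fun s => (t < s)%O || (s < t)%O) L.

(* Layer functions are partial: [None] means that the side conditions fail. *)

Definition append_fun (si sj : S) (w : seq U) (P : lword) : option lword :=
  if child (sj :: si :: labels P) si sj
     && fresh [seq s <- labels P | (s != si) && (s != sj)] sj
  then Some (P ++ mark w sj) else None.

Definition insert_fun (si sj sk : S) (w : seq U) (P : lword) : option lword :=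
  if [&& sj \in labels P, child (si :: labels P) si sj,
         child (sk :: si :: labels P) si sk,
         child (sk :: si :: labels P) sk sj
       & fresh [seq s <- labels P | (s != si) && ~~ (sj <= s)%O] sk]
  then Some (P ++ mark w sk) else None.

Definition delete_fun (si sj : S) (P : lword) : option lword :=
  if (sj \in labels P) && child (si :: labels P) si sj
  then Some [seq p <- P | ~~ (sj <= p.2)%O] else None.

(* [Q] extends [P] with a copy of the subtree of labels rooted at [sj]: [ts]
   lists the copied labels, parents before their descendants, and [rho] sends
   each of them to its new label.  The new labels form an isomorphic subtree
   below [si], incomparable with the labels of [P] other than [si], so that
   [rho t] is a child of [rho t0] whenever [t] is a child of [t0]. *)
Definition copy_of (si sj : S) (P Q : lword) : Prop :=
  [/\ sj \in labels P, child (si :: labels P) si sj &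
  exists (ts : seq S) (rho : S -> S),
  [/\ [/\ uniq ts, ts =i [seq t <- labels P | (sj <= t)%O]
        & pairwise (fun t t' => ~~ (t' < t)%O) ts],
      [/\ child (rho sj :: si :: labels P) si (rho sj),
          {in ts &, {mono rho : t t' / (t <= t')%O}}
        & {in ts, forall t, fresh [seq s <- labels P | s != si] (rho t)}]
    & Q = P ++ flatten [seq mark (plain (proj P t)) (rho t) | t <- ts]]].

(* The copy operation does not name the labels it creates, so any function
   choosing them is a copy function; it is undefined only where no copy is
   possible. *)
Definition is_copy_fun (si sj : S) (f : lword -> option lword) : Prop :=
  forall P, match f P with
            | Some Q => copy_of si sj P Q
            | None => ~ exists Q, copy_of si sj P Q
            end.

Inductive elementary (si : S) (K2 : nat) : (lword -> option lword) -> Prop :=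
| ElAppend sj w : size w <= K2 -> elementary si K2 (append_fun si sj w)
| ElInsert sj sk w : size w <= K2 -> elementary si K2 (insert_fun si sj sk w)
| ElDelete sj : elementary si K2 (delete_fun si sj)
| ElCopy sj f : is_copy_fun si sj f -> elementary si K2 f.

Inductive layer_fun (si : S) : nat -> nat -> (lword -> option lword) -> Prop :=
| LayerId K2 : layer_fun si 0 K2 Some
| LayerComp K1 K2 f F : elementary si K2 f -> layer_fun si K1 K2 F ->
    layer_fun si K1.+1 K2 (fun P => obind f (F P)).

(* The word Gamma $ Delta, as the pair of its layers. *)
Definition gword : Type := (lword * lword)%type.

(* [Pop (Some sj)] specifies the popped label, [Pop None] does not. *)
Inductive rule_kind : Type := Simple | Pop of option S.

(* The rule rewriting the visible prefix [rpre ++ [:: (rsym, rlab)]]. *)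
Record rule : Type := Rule {
  rkind : rule_kind;
  rpre : lword;
  rsym : U;
  rlab : S;
  rrhs : lword;
  rfun : lword -> option lword
}.

Definition rlhs (r : rule) : lword := rcons (rpre r) (rsym r, rlab r).

(* Rules bear concrete labels; a rule meant for arbitrary labels is the set of
   its instances, so that the set of rules need not be finite. *)
Record grammar : Type := Grammar {
  rules : rule -> Prop;
  gK1 : nat;
  gK2 : nat;
  gvis : lword;
  ginv : lword;
  _ : pairwise (fun p q : U * S => (q.2 <= p.2)%O) gvis;
  _ : forall r, rules r -> all (fun p => (rlab r <= p.2)%O) (rrhs r);
  _ : forall r, rules r -> layer_fun (rlab r) gK1 gK2 (rfun r)
}.

(* [L] consists of the labels used so far.  The label of the rule and its
   ancestors lie below every descendant of that label, and are disregarded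
   when freshness of the descendants is considered. *)
Definition fresh_rhs (L : seq S) (r : rule) : bool :=
  all (fun p => (p.2 == rlab r) || fresh [seq s <- L | ~~ (s <= rlab r)%O] p.2)
      (rrhs r).

Inductive step (G : grammar) (L : seq S) : gword -> gword -> Prop :=
| StepSimple r Theta Psi Psi' :
    rules G r -> rkind r = Simple -> fresh_rhs L r ->
    rfun r Psi = Some Psi' ->
    step G L (rlhs r ++ Theta, Psi) (rrhs r ++ Theta, Psi')
| StepPop r o sj Theta Psi Psi' :
    rules G r -> rkind r = Pop o -> (if o is Some s then sj = s else True) ->
    child L (rlab r) sj -> fresh_rhs L r ->
    rfun r Psi = Some Psi' ->
    step G L (rlhs r ++ Theta, Psi) (proj Psi sj ++ rrhs r ++ Theta, Psi').

Definition used (u : sequence gword) (k : nat) : seq S :=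
  flatten [seq if entry u m is Some (Gamma, Delta)
               then labels Gamma ++ labels Delta else [::] | m <- iota 0 k.+1].

Definition is_trace (G : grammar) (u : sequence gword) : Prop :=
  entry u 0 = Some (gvis G, ginv G) /\
  forall k x y, entry u k = Some x -> entry u k.+1 = Some y ->
    step G (used u k) x y.

(* The maximum is taken as a least upper bound, hence is 0 without rules. *)
Definition max_rewritten (G : grammar) (N : nat) : Prop :=
  (forall r, rules G r -> size (rlhs r) <= N) /\
  (forall M, (forall r, rules G r -> size (rlhs r) <= M) -> N <= M).

(* [Phi] covers the first [N] letters of [Gamma], those a rule may rewrite.  In
   a visible layer with fewer than [N] letters, all the letters may be
   rewritten and only the empty suffix is stable; [minn] accounts for this
   case.  With [N <= size Phi] instead, under rules a -> a and bb -> b, the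
   infinite trace a, a, a, ... would have no stable suffix at all. *)
Definition permanently_stable (N : nat) (u : sequence gword) (i j : nat)
    (Theta : lword) : Prop :=
  (forall k Gamma Delta, i <= k < j -> entry u k = Some (Gamma, Delta) ->
     exists2 Phi, Gamma = Phi ++ Theta & minn N (size Gamma) <= size Phi) /\
  (forall Gamma Delta, entry u j = Some (Gamma, Delta) ->
     exists Phi, Gamma = Phi ++ Theta).

Definition turchin_pair (N : nat) (u : sequence gword) (i j : nat) : Prop :=
  i < j /\
  exists Gi Di Gj Dj,
    [/\ entry u i = Some (Gi, Di), entry u j = Some (Gj, Dj) &
    exists Phi Phi' Psi Theta0,
      [/\ Gi = Phi ++ Theta0, Gj = Phi' ++ Psi ++ Theta0,
          plain Phi = plain Phi' & permanently_stable N u i j Theta0]].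

End LayeredWords.

Arguments lword {d} U S.
Arguments gword {d} U S.
Arguments rule_kind {d} S.
Arguments rule {d} U S.
Arguments grammar {d} U S.

(* Main.v *)
(** In an infinite trace, call a time [i] minimal if no later visible layer is
    shorter than the one at [i]; minimal times are unbounded.  From a minimal
    time [i] on, the visible layer has at least [N] letters in front of
    [drop N Gamma_i] (or else that suffix is empty), so no rule ever touches
    this suffix.  Hence two minimal times at which the first [N] visible letters
    spell the same plain word form a Turchin pair.  The alphabet is finite, so
    one plain word occurs at infinitely many minimal times, and [R] is well
    binary with respect to the resulting subsequence. *)

Require Import Defs.
From mathcomp Require Import all_boot all_order.
From mathcomp Require Import boolp zify.

Set Implicit Arguments.
Unset Strict Implicit.
Unset Printing Implicit Defensive.

Definition unbounded (Q : nat -> Prop) : Prop := forall n, exists2 i, n < i & Q i.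

(** Otherwise each value has a bound on its times, and a time past the largest bound has no value
    left. *)
Lemma unbounded_pigeonhole (T : finType) (Q : nat -> Prop) (c : nat -> T) :
  unbounded Q -> exists x, unbounded (fun i => Q i /\ c i = x).
Proof.
move=> Qinf; apply: contrapT => /forallNP Qfin.
have /choice[b bP] : forall x, exists n, forall i, n < i -> ~ (Q i /\ c i = x).
  move=> x; have /existsNP[n nP] := Qfin x.
  by exists n => i ni Qi; apply: nP; exists i.
have [i bi Qi] := Qinf (\max_x b x).
by apply: (bP (c i) i) => //; apply: leq_ltn_trans bi; apply: leq_bigmax.
Qed.

Lemma unbounded_subsequence (Q : nat -> Prop) :
  unbounded Q ->
  exists2 g : nat -> nat, {homo g : i j / i < j} & forall n, Q (g n).
Proof.
move=> Qinf; have /choice[h hP] : forall n, exists i, n < i /\ Q i.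
  by move=> n; have [i] := Qinf n; exists i.
(* The shift to [n.+1] skips the seed [0], which need not satisfy [Q]. *)
exists (fun n => iter n.+1 h 0) => [|n]; last by have [] := hP (iter n h 0).
apply: homo_ltn => [j i k|n]; first exact: ltn_trans.
by have [] := hP (iter n.+1 h 0).
Qed.

Definition future_min (a : nat -> nat) (i : nat) : Prop :=
  forall k, i <= k -> a i <= a k.

(** Descent on the value: a time that is not minimal has a later one with a smaller value. *)
Lemma unbounded_future_min (a : nat -> nat) : unbounded (future_min a).
Proof.
move=> n.
suff min_after m i : n < i -> a i < m -> exists2 k, n < k & future_min a k.
  exact: (min_after (a n.+1).+1 n.+1).
elim: m i => // m IHm i ni aim.
have [|/existsNP[k /not_implyP[ik /negP]]] := pselect (future_min a i).
  by exists i.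
rewrite -ltnNge => aki; apply: (IHm k); first exact: leq_trans ik.
exact: leq_trans aki _.
Qed.

Lemma suffix_drop_cat (T : eqType) (n : nat) (s s' t : seq T) :
  s = s' ++ t -> minn n (size s) <= size s' -> suffix t (drop n s).
Proof.
(* Either the [n] dropped letters lie within [s'], or [t] is empty. *)
move=> -> {s}; rewrite size_cat geq_min => /orP[ns'|].
  rewrite drop_cat; case: ltngtP ns' => // [_|->] _; first exact: suffix_suffix.
  by rewrite subnn drop0 suffix_refl.
by rewrite -{2}[size s']addn0 leq_add2l leqn0 size_eq0 => /eqP->; rewrite suffix0s.
Qed.

Section Traces.

Variables (d : Order.disp_t) (U : finType) (S : porderType d).
Variables (G : grammar U S) (N : nat).
Hypothesis lhs_le : forall r, rules G r -> size (rlhs r) <= N.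

(** A left-hand side has at most [N] letters, so [drop N x.1] lies within the part that the rule
    leaves in place. *)
Lemma step_suffix L (x y : gword U S) Theta :
  step G L x y -> suffix Theta (drop N x.1) -> suffix Theta y.1.
Proof.
have drop_suffix (s t : lword U S) : size s <= N -> suffix (drop N (s ++ t)) t.
  move=> sN; rewrite -{1}(subnK sN) -drop_drop drop_size_cat //.
  exact: suffix_drop.
case=> [r Th Psi Psi' Gr _ _ _|r o sj Th Psi Psi' Gr _ _ _ _ _] /= ThS.
  apply: suffix_trans ThS (suffix_trans (drop_suffix _ _ (lhs_le Gr)) _).
  exact: suffix_suffix.
apply: suffix_trans ThS (suffix_trans (drop_suffix _ _ (lhs_le Gr)) _).
by rewrite catA suffix_suffix.
Qed.

Variable f : nat -> gword U S.
Hypothesis trace_f : is_trace G (Inf f).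

Let len k := size (f k).1.

Lemma future_min_suffix i k : future_min len i -> i <= k ->
  suffix (drop N (f i).1) (drop N (f k).1).
Proof.
move=> imin ik; rewrite -(subnKC ik); elim: (k - i) => [|m IHm].
  by rewrite addn0 suffix_refl.
have := step_suffix (trace_f.2 (i + m) _ _ erefl erefl) IHm.
rewrite -addnS => /suffixP[s' eqf].
(* The step may use up letters in front of the suffix; minimality of [i] restores the margin of
   [N]. *)
apply: (suffix_drop_cat eqf).
have := imin (i + m.+1) (leq_addr _ _).
by rewrite /len eqf size_cat size_drop; move: (size s') (size _) => p q; lia.
Qed.

Lemma future_min_turchin i j : i < j -> future_min len i ->
  plain (take N (f i).1) = plain (take N (f j).1) ->
  turchin_pair N (Inf f) i j.
Proof.
move=> ij imin eq_plain; split=> //.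
exists (f i).1, (f i).2, (f j).1, (f j).2; split; rewrite /= -?surjective_pairing //.
have /suffixP[Psi eqj] := future_min_suffix imin (ltnW ij).
exists (take N (f i).1), (take N (f j).1), Psi, (drop N (f i).1).
split; rewrite -?eqj ?cat_take_drop //; split=> [k Ga De /andP[ik _] [eqk]|Ga De [eqj']].
  have /suffixP[Psik] := future_min_suffix imin ik; rewrite eqk /= => eqd.
  exists (take N Ga ++ Psik); first by rewrite -catA -eqd cat_take_drop.
  by rewrite size_cat size_take_min leq_addr.
exists (take N Ga ++ Psi); move: eqj; rewrite eqj' /= => eqj.
by rewrite -catA -eqj cat_take_drop.
Qed.

End Traces.

Theorem proposition4 (d : Order.disp_t) (U : finType) (S : porderType d)
    (R : gword U S -> gword U S -> Prop)
    (hR : well_binary R (fun _ : sequence (gword U S) => True))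
    (G : grammar U S) (N : nat) (hN : max_rewritten G N)
    (u : sequence (gword U S)) (hu : is_trace G u)
    (hbad : forall (i j : nat) (x y : gword U S), i < j ->
       entry u i = Some x -> entry u j = Some y ->
       ~ (turchin_pair N u i j /\ R x y)) :
  is_finite u.
Proof.
case: u hu hbad => [s|f] trace_f hbad; first by exists s.
have lhs_le := hN.1.
(* Words of length at most [N] form a finite type; the default value of [insub_bseq] never occurs,
   by [preE]. *)
pose pre i : N.-bseq U := insub_bseq N (plain (take N (f i).1)).
have preE i : pre i = plain (take N (f i).1) :> seq U.
  by apply: insubdK; rewrite unfold_in size_map size_take_min geq_minl.
have [w /unbounded_subsequence[g g_mono gP]] :=
  unbounded_pigeonhole pre (unbounded_future_min (fun k => size (f k).1)).
have [|s] // := hR (Inf (f \o g)) I.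
move=> i j x y ij /= [<-] [<-] Rij; have gij := g_mono _ _ ij.
apply: (hbad (g i) (g j) _ _ gij erefl erefl); split=> //.
have [[imin prei] [_ prej]] := (gP i, gP j).
by apply: (future_min_turchin lhs_le trace_f gij imin); rewrite -!preE prei prej.
Qed.
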